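(* Let $p$ be a prime, $r\geq 1$ an integer, $n=p^r+1$ and $n>3$. Any nonempty monotone and non-evasive property $\mathcal{P}$ of graphs on $n$ vertices contains one of the two graphs $K_{p^r}\cup K_1$ or $K_{p^r,1}$. In particular $\dim\mathcal{P}\geq n-2$. Moreover, if $\mathcal{P}$ is nontrivial, then $\mathcal{P}$ cannot contain both $K_{p^r}\cup K_1$ and $K_{p^r,1}$.
   Context: Graphs are finite and simple. A graph property $\mathcal{P}$ on $n$ vertices is a collection of graphs with vertex set $\{1,\ldots,n\}$ (identified with their edge sets) that is closed under isomorphism of graphs. Its complexity $c(\mathcal{P})$ is the minimum $k$ such that some adaptive strategy of questions of the form ''is $\{i,j\}$ an edge of $G$?'' always determines, for every unknown graph $G$ on $\{1,\ldots,n\}$, whether $G\in\mathcal{P}$ using at most $k$ questions. $\mathcal{P}$ is evasive if $c(\mathcal{P})=\binom{n}{2}$, and non-evasive otherwise. $\mathcal{P}$ is monotone if it is closed under removal of edges. $\mathcal{P}$ is trivial if it is empty or consists of all graphs on $\{1,\ldots,n\}$, and nontrivial otherwise. A nonempty monotone graph property $\mathcal{P}$ is regarded as a simplicial complex on the set of two-element subsets of $\{1,\ldots,n\}$, whose faces are the edge sets of graphs in $\mathcal{P}$; a graph with $m$ edges is a face of dimension $m-1$, so $\dim\mathcal{P}$ is the maximum number of edges of a graph in $\mathcal{P}$ minus $1$. $K_m$ is the complete graph on $m$ vertices, $K_{a,b}$ is the complete bipartite graph, and $G_1\cup G_2$ denotes the disjoint union of graphs. *)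

(* Defs.v *)
From HB Require Import structures.
From mathcomp Require Import all_boot all_order all_algebra all_fingroup.
From mathcomp Require Import boolp.

Set Implicit Arguments.
Unset Strict Implicit.
Unset Printing Implicit Defensive.

(* A finite simple graph on 'I_n is identified with its set of edges. *)

Record edge (n : nat) := Edge { ends : {set 'I_n}; card_ends : #|ends| == 2 }.

HB.instance Definition _ (n : nat) := [isSub for @ends n].
HB.instance Definition _ (n : nat) := [Finite of edge n by <:].

Notation graph n := {set edge n}.

Definition adj (n : nat) (G : graph n) : rel 'I_n :=
  fun i j => [exists e in G, ends e == [set i; j]].

Definition isomorphic (n : nat) (G H : graph n) : Prop :=
  exists s : {perm 'I_n}, forall i j, adj H (s i) (s j) = adj G i j.

Definition complete (m : nat) : graph m := [set: edge m].

Definition disjoint_union (a b : nat) (G : graph a) (H : graph b) :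
    graph (a + b) :=
  [set e : edge (a + b) | [exists f in G, ends e == @lshift a b @: ends f]
                       || [exists f in H, ends e == @rshift a b @: ends f]].

Definition complete_bipartite (a b : nat) : graph (a + b) :=
  [set e : edge (a + b) |
     [exists i : 'I_a, exists j : 'I_b,
        ends e == [set lshift b i; rshift a j]]].

(* An adaptive strategy for an unknown A : {set E} is a binary decision tree:
   [Query e t0 t1] asks whether e \in A, continuing with t0 if not and with t1
   if so; [Leaf b] stops and answers b. *)

Inductive strategy (E : Type) :=
  | Leaf of bool
  | Query of E & strategy E & strategy E.
Arguments Leaf {E} b.

Fixpoint answer (E : finType) (t : strategy E) (A : {set E}) : bool :=
  match t with
  | Leaf b => b
  | Query e t0 t1 => if e \in A then answer t1 A else answer t0 A
  end.

Fixpoint depth (E : Type) (t : strategy E) : nat :=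
  match t with
  | Leaf _ => 0
  | Query _ t0 t1 => (maxn (depth t0) (depth t1)).+1
  end.

Definition decides (E : finType) (t : strategy E) (P : {set {set E}}) : Prop :=
  forall A : {set E}, answer t A = (A \in P).

Definition decidable_within (E : finType) (P : {set {set E}}) (k : nat) :
    bool :=
  `[< exists t : strategy E, decides t P /\ depth t <= k >].

Fixpoint query_all (E : finType) (P : {set {set E}}) (s : seq E)
    (B : {set E}) : strategy E :=
  match s with
  | [::] => Leaf (B \in P)
  | e :: s' => Query e (query_all P s' B) (query_all P s' (e |: B))
  end.

Lemma answer_query_all (E : finType) (P : {set {set E}}) (s : seq E)
    (B A : {set E}) :
  answer (query_all P s B) A = (B :|: [set x in s | x \in A] \in P).
Proof.
elim: s B => [|e s IHs] B /=.
  by congr (_ \in P); apply/setP => x; rewrite !inE orbF.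
case: ifP => eA; rewrite IHs; congr (_ \in P); apply/setP => x; rewrite !inE.
  by case: (eqVneq x e) => [->|_]; rewrite ?eA ?orbT.
by case: (eqVneq x e) => [->|_]; rewrite ?eA ?andbF.
Qed.

Lemma decidable_withinW (E : finType) (P : {set {set E}}) :
  exists k, decidable_within P k.
Proof.
exists (depth (query_all P (enum E) set0)).
apply/asboolP.
exists (query_all P (enum E) set0); split=> // A.
rewrite answer_query_all; congr (_ \in P).
by apply/setP => x; rewrite !inE mem_enum.
Qed.

Definition complexity (E : finType) (P : {set {set E}}) : nat :=
  ex_minn (decidable_withinW P).

Definition graph_property (n : nat) (P : {set graph n}) : Prop :=
  forall G H : graph n, isomorphic G H -> G \in P -> H \in P.

Definition monotone (n : nat) (P : {set graph n}) : Prop :=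
  forall G H : graph n, H \subset G -> G \in P -> H \in P.

Definition evasive (n : nat) (P : {set graph n}) : bool :=
  complexity P == 'C(n, 2).

Definition trivial_property (n : nat) (P : {set graph n}) : bool :=
  (P == set0) || (P == setT).

(* A face with m elements has dimension m - 1; the value is an integer because
   the complex whose only face is empty has dimension -1.  This is meant for a
   nonempty K only. *)
Definition complex_dim (E : finType) (K : {set {set E}}) : int :=
  ((\max_(A in K) #|A|)%:Z - 1)%R.

(* Main.v *)
Require Import Defs.
From mathcomp Require Import all_boot all_order all_algebra all_fingroup.
From mathcomp Require Import all_solvable all_field.
From mathcomp Require Import boolp.

(* Oliver's fixed point argument, carried out over k = F_p in the order complex
   of the poset X of nonempty members of P.  A decision tree asking fewer than
   #|E| questions shows that X is acyclic: querying e splits X into the faces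
   avoiding e and the link of e, and both are acyclic by induction.  The affine
   group of the field F of order p ^ r acts on the vertices F + {apex}.  By Smith
   theory the graphs fixed by the p-group of translations still form an acyclic
   poset, so by the Lefschetz formula for a generator of the cyclic group of
   homotheties the graphs in X fixed by all affine maps have Euler
   characteristic 1 modulo p.  Affine maps are 2-transitive on F, so besides the
   complete graph the only candidates are the two graphs of the theorem, which
   are incomparable: exactly one of them lies in P when P is nontrivial. *)

Set Implicit Arguments.
Unset Strict Implicit.
Unset Printing Implicit Defensive.

Import GRing.Theory.

(** * The order complex of a finite poset *)

Section Alternating.

Local Open Scope ring_scope.

(** The terms at (x, y) and (y, x) cancel once [I] is ordered by [enum_rank]. The diagonal is a
    separate hypothesis because antisymmetry does not kill it in characteristic 2. *)
Lemma sum_alternating (k : pzRingType) (I : finType) (a : I -> I -> k) :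
  (forall x, a x x = 0) -> (forall x y, a x y = - a y x) ->
  \sum_x \sum_y a x y = 0.
Proof.
move=> a0 aN; pose lt (x y : I) := (enum_rank x < enum_rank y)%N.
have split2 x : \sum_y a x y = \sum_(y | lt x y) a x y + \sum_(y | lt y x) a x y.
  rewrite (bigID (lt x)) /= (bigD1 (P := fun y => ~~ lt x y) x) /lt ?ltnn//=.
  rewrite a0 add0r; congr (_ + _); apply: eq_bigl => y.
  by rewrite -leqNgt andbC ltn_neqAle -(inj_eq enum_rank_inj).
rewrite (eq_bigr _ (fun x _ => split2 x)) big_split /=.
rewrite [X in _ + X](exchange_big_dep predT)//=.
rewrite -big_split big1 //= => x _; rewrite -big_split big1 //= => y _.
by rewrite (aN y) subrr.
Qed.

End Alternating.

Section OrderComplex.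

Local Open Scope ring_scope.

Context (k : fieldType) (U : finType) (lt : rel U).
Context (lt_irr : irreflexive lt) (lt_trans : transitive lt).
Implicit Types (x y z : U) (B C : {set U}) (X Y : {set U}) (f g : {set U} -> k).

Definition comparable x y := [|| x == y, lt x y | lt y x].

Definition chains X : {set {set U}} :=
  [set B : {set U} | (B \subset X) &&
     [forall x in B, forall y in B, comparable x y]].

Lemma lt_asym x y : lt x y -> lt y x = false.
Proof. by move=> xy; apply/negP => /(lt_trans xy); rewrite lt_irr. Qed.

Lemma comparableC x y : comparable x y = comparable y x.
Proof. by rewrite /comparable eq_sym; congr (_ || _); rewrite orbC. Qed.

Lemma chainsP X B :
  reflect (B \subset X /\ {in B &, forall x y, comparable x y}) (B \in chains X).
Proof.
rewrite inE; apply: (iffP andP) => -[-> H]; split=> //.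
  by move=> x y xB yB; move/forall_inP/(_ x xB)/forall_inP/(_ y yB): H.
by apply/forall_inP => x xB; apply/forall_inP => y yB; apply: H.
Qed.

Lemma chains_sub X B C : B \subset C -> C \in chains X -> B \in chains X.
Proof.
move=> BC /chainsP[CX cC]; apply/chainsP; split; first exact: subset_trans CX.
by move=> x y /(subsetP BC) xC /(subsetP BC) yC; apply: cC.
Qed.

(** For x in a chain the exponent is the position of x counted from 0, so this is the usual
    incidence sign of the simplicial boundary. *)
Definition sgn x B : k := (-1) ^+ #|[set y in B | lt y x]|.

Lemma sgn_sqr x B : sgn x B * sgn x B = 1.
Proof. by rewrite -expr2 sqrr_sign. Qed.

Lemma sgnU1 x y B : y \notin B -> sgn x (y |: B) = sgn x B * (-1) ^+ lt y x.
Proof.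
move=> yB; rewrite /sgn -exprD; congr (_ ^+ _).
have -> : [set z in y |: B | lt z x] =
    if lt y x then y |: [set z in B | lt z x] else [set z in B | lt z x].
  apply/setP => z; case: ifP => yx; rewrite !inE;
    by case: (eqVneq z y) => //= ->; rewrite ?yx ?andbF.
by case: ifP => yx; rewrite ?addn0 // cardsU1 inE (negPf yB) addnC.
Qed.

Lemma sgnD1 x B : sgn x (B :\ x) = sgn x B.
Proof.
rewrite /sgn; congr (_ ^+ _); apply: eq_card => z; rewrite !inE.
by case: eqVneq => [->|]; rewrite //= lt_irr andbF.
Qed.

(* A chain B has degree #|B| and the empty chain is included, so that [acyclic]
   below means vanishing reduced homology. *)
Definition del x f B : k := if x \in B then 0 else sgn x B * f (x |: B).
Definition add x f B : k := if x \in B then sgn x B * f (B :\ x) else 0.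
(** Functions stand for simplicial chains, with coefficient [f B] at [B]; the boundary gathers at
    [B] the coefficients of the sets that have one more element. *)
Definition bd f B : k := \sum_x del x f B.

Lemma eq_del x f g : f =1 g -> del x f =1 del x g.
Proof. by move=> fg B; rewrite /del fg. Qed.

Lemma eq_bd f g : f =1 g -> bd f =1 bd g.
Proof. by move=> fg B; apply: eq_bigr => x _; apply: eq_del. Qed.

Lemma delD x f g B : del x (fun B => f B + g B) B = del x f B + del x g B.
Proof. by rewrite /del; case: ifP => _; rewrite ?addr0 ?mulrDr. Qed.

Lemma delN x f B : del x (fun B => - f B) B = - del x f B.
Proof. by rewrite /del; case: ifP => _; rewrite ?oppr0 ?mulrN. Qed.

Lemma bdD f g B : bd (fun B => f B + g B) B = bd f B + bd g B.
Proof. by rewrite -big_split; apply: eq_bigr => x _; rewrite delD. Qed.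

Lemma bdN f B : bd (fun B => - f B) B = - bd f B.
Proof. by rewrite -sumrN; apply: eq_bigr => x _; rewrite delN. Qed.

Lemma bdB f g B : bd (fun B => f B - g B) B = bd f B - bd g B.
Proof. by rewrite bdD bdN. Qed.

Lemma bd0 f : f =1 (fun=> 0) -> bd f =1 (fun=> 0).
Proof.
by move=> f0 B; apply: big1 => x _; rewrite /del f0 mulr0 if_same.
Qed.

Lemma del_sum x (I : finType) (F : I -> {set U} -> k) B :
  del x (fun B => \sum_i F i B) B = \sum_i del x (F i) B.
Proof.
rewrite /del; case: ifP => _; first by rewrite big1.
by rewrite mulr_sumr.
Qed.

Definition supported f (S : {set {set U}}) := forall B, B \notin S -> f B = 0.

Lemma del_supported x f X : supported f (chains X) -> supported (del x f) (chains X).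
Proof.
move=> fX B BX; rewrite /del; case: ifP => // _; rewrite fX ?mulr0 //.
by apply: contra BX; apply: chains_sub; apply: subsetUr.
Qed.

(** Exactly one of x and y lies below the other, so exactly one of the two signs changes when the
    order of removal is swapped. This needs x and y comparable, hence the support on chains. *)
Lemma delC x y f X B : supported f (chains X) ->
  del x (del y f) B = - del y (del x f) B.
Proof.
move=> fX; rewrite /del !inE (eq_sym y x).
case: (boolP (x \in B)) => xB; case: (boolP (y \in B)) => yB;
  rewrite ?orbT ?mulr0 ?oppr0 //.
case: eqVneq => [|xy] /=; first by rewrite !mulr0 oppr0.
rewrite setUCA; set C := x |: (y |: B).
case: (boolP (C \in chains X)) => [|/fX ->]; last by rewrite !mulr0 oppr0.
move=> /chainsP[_ cC]; rewrite !mulrA -mulNr; congr (_ * _).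
have /cC : x \in C by rewrite !inE eqxx.
rewrite !sgnU1 //.
have /[swap]/[apply] : y \in C by rewrite !inE eqxx orbT.
case/or3P => [xy0|xy0|xy0]; first by rewrite xy0 in xy.
  by rewrite xy0 (lt_asym xy0) expr1 expr0 mulr1 mulrN1 mulrN mulrC.
by rewrite xy0 (lt_asym xy0) expr1 expr0 mulr1 mulrN1 mulrN opprK mulrC.
Qed.

Lemma del_bd x f X B : supported f (chains X) ->
  del x (bd f) B = - bd (del x f) B.
Proof.
move=> fX; rewrite [LHS]del_sum -sumrN; apply: eq_bigr => y _.
exact: delC fX.
Qed.

Lemma bd_bd f X : supported f (chains X) -> bd (bd f) =1 (fun=> 0).
Proof.
move=> fX B; rewrite [LHS](eq_bigr _ (fun x _ => del_sum x _ B)).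
apply: sum_alternating => x.
  by rewrite /del; case: ifP => // _; rewrite setU11 mulr0.
by move=> y; apply: delC fX.
Qed.

Lemma del_add x g : (forall B, x \in B -> g B = 0) -> del x (add x g) =1 g.
Proof.
move=> g0 B; rewrite /del /add; case: ifP => [/g0 //|/negbT xB].
by rewrite setU11 setU1K // -[in sgn x (x |: B)]sgnD1 setU1K // mulrA sgn_sqr mul1r.
Qed.

(** Homotopy formula for a cone with apex x. Removing x gives back [g]; removing any other y
    anticommutes with adding x, by the same sign count as in [delC]. *)
Lemma bd_add x g : (forall B, g B != 0 -> {in B, forall y, comparable x y}) ->
  forall B, bd (add x g) B = g B - add x (bd g) B.
Proof.
move=> gx B; apply/eqP; rewrite -subr_eq0 opprB addrA subr_eq0; apply/eqP.
have -> : add x (bd g) B = \sum_y add x (del y g) B.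
  by rewrite /add; case: ifP => _; [rewrite -mulr_sumr | rewrite big1].
rewrite /bd -big_split (bigD1 x) //= big1 ?addr0; last first.
  move=> y yx; rewrite /add /del !inE (eq_sym x) (negPf yx) /=.
  case: (boolP (x \in B)) => xB; case: (boolP (y \in B)) => yB;
    rewrite ?mulr0 ?addr0 //.
  have -> : (y |: B) :\ x = y |: (B :\ x).
    by apply/setP => z; rewrite !inE; case: (eqVneq z y) => // ->; rewrite yx.
  have [->|/gx/(_ y)] := eqVneq (g (y |: B :\ x)) 0; first by rewrite !mulr0 addr0.
  rewrite setU11 => /(_ isT) xy; rewrite !mulrA -mulrDl.
  have -> : sgn y B = sgn y (B :\ x) * (-1) ^+ lt x y.
    by rewrite -[in LHS](setD1K xB) sgnU1 ?setD11.
  rewrite (sgnU1 _ yB).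
  case/or3P: xy => [/eqP xy|xy|xy]; first by rewrite xy eqxx in yx.
    by rewrite xy (lt_asym xy) expr1 expr0 mulrN1 mulr1 mulNr (mulrC (sgn x B)) addNr mul0r.
  by rewrite xy (lt_asym xy) expr1 expr0 mulrN1 mulr1 mulrN (mulrC (sgn x B)) addNr mul0r.
rewrite /add /del; case: (boolP (x \in B)) => xB.
  by rewrite setD11 mulrA sgnD1 sgn_sqr mul1r add0r setD1K.
rewrite setU11 addr0 setU1K // -[in sgn x (x |: B)]sgnD1 setU1K //.
by rewrite mulrA sgn_sqr mul1r.
Qed.

Definition dchains X i := [set B in chains X | #|B| == i].

Lemma in_dchains X i B : (B \in dchains X i) = (B \in chains X) && (#|B| == i).
Proof. by rewrite inE. Qed.

Definition acyclic X := forall i f,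
  supported f (dchains X i) -> bd f =1 (fun=> 0) ->
  exists2 g, supported g (dchains X i.+1) & bd g =1 f.

Lemma dchains_supported f X i : supported f (dchains X i) -> supported f (chains X).
Proof. by move=> fX B BX; apply: fX; rewrite in_dchains (negPf BX). Qed.

Lemma supportedP f S : supported f S <-> (forall B, f B != 0 -> B \in S).
Proof.
split=> fS B.
  by apply: contraR => /fS ->.
by apply: contraNeq; apply: fS.
Qed.

Lemma chains_mono X Y : X \subset Y -> chains X \subset chains Y.
Proof.
move=> XY; apply/subsetP => B /chainsP[BX cB]; apply/chainsP; split=> //.
exact: subset_trans XY.
Qed.

Lemma bd_dchains f X i : supported f (dchains X i.+1) ->
  supported (bd f) (dchains X i).
Proof.
move=> fX B BX; apply: big1 => x _; rewrite /del; case: ifP => // /negbT xB.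
rewrite fX ?mulr0 //; apply: contra BX; rewrite !in_dchains cardsU1 xB eqSS.
by move=> /andP[BX ->]; rewrite andbT (chains_sub (subsetUr [set x] B)).
Qed.

Lemma supported_add x f X Y i : x \in Y -> X \subset Y ->
  {in X, forall y, comparable x y} ->
  supported f (dchains X i) -> supported (add x f) (dchains Y i.+1).
Proof.
move=> xY XY xX /supportedP fX; apply/supportedP => B.
rewrite /add; case: ifP => [xB|]; last by rewrite eqxx.
rewrite mulf_eq0 negb_or => /andP[_ /fX]; rewrite in_dchains => /andP[/chainsP[BX cB]].
rewrite in_dchains (cardsD1 x B) xB add1n eqSS => ->; rewrite andbT.
rewrite -(setD1K xB); move: (B :\ x) BX cB => C CX cC.
apply/chainsP; split; first by rewrite subUset sub1set xY (subset_trans CX XY).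
move=> y z; rewrite !inE => /orP[/eqP->|yC] /orP[/eqP->|zC].
- by rewrite /comparable eqxx.
- by apply: xX; apply: (subsetP CX).
- by rewrite comparableC; apply: xX; apply: (subsetP CX).
- exact: cC.
Qed.

(** By [bd_add], [add a f] is a primitive of any cycle [f]. *)
Lemma cone_acyclic a X : a \in X -> {in X, forall y, comparable a y} -> acyclic X.
Proof.
move=> aX aP i f fX f0; exists (add a f); first exact: supported_add fX.
move=> B; rewrite bd_add; last first.
  move=> C /(proj1 (supportedP _ _) fX); rewrite in_dchains => /andP[/chainsP[CX _] _] y.
  by move=> /(subsetP CX)/aP.
by rewrite /add; case: ifP; rewrite ?f0 ?mulr0 subr0.
Qed.

(** A Mayer-Vietoris argument: the star of x is a cone attached to [X :\ x] along the link [L]. For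
    a cycle [f], [del x f] is a cycle on the link, hence some [bd g]; adding [bd (add x g)] to [f]
    clears every chain through x and leaves a cycle of [X :\ x]. *)
Lemma point_acyclic x X : x \in X -> acyclic (X :\ x) ->
  acyclic [set y in X :\ x | comparable x y] -> acyclic X.
Proof.
move=> xX acX; set L := [set y in _ | _] => acL i f fX f0.
have fX' := dchains_supported fX.
have LX : L \subset X by apply/subsetP => y; rewrite !inE => /andP[/andP[]].
have Lx : {in L, forall y, comparable x y} by move=> y; rewrite !inE => /andP[].
have del0 : bd (del x f) =1 (fun=> 0).
  move=> B; apply/eqP; rewrite -oppr_eq0 -(del_bd x B fX'); apply/eqP.
  by rewrite /del f0 mulr0 if_same.
have [g gL gf] : exists2 g, supported g (dchains L i) & bd g =1 del x f.
  (* In degree 0 only the empty chain carries [f], so [del x f] vanishes. *)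
  case: i fX => [|i] fX.
    exists (fun=> 0) => // B; rewrite bd0 //; apply/esym.
    rewrite /del; case: ifP => // /negbT xB; rewrite fX ?mulr0 //.
    by rewrite in_dchains cardsU1 xB andbF.
  apply: acL del0; apply/supportedP => B; rewrite /del.
  case: ifP => [|/negbT xB]; first by rewrite eqxx.
  rewrite mulf_eq0 negb_or => /andP[_ /(proj1 (supportedP _ _) fX)].
  rewrite !in_dchains cardsU1 xB => /andP[/chainsP[BX cB]]; rewrite eqSS => ->.
  rewrite andbT; apply/chainsP; split; last first.
    by move=> y z yB zB; apply: cB; rewrite inE ?yB ?zB orbT.
  apply/subsetP => y yB; rewrite !inE (subsetP BX) ?inE ?yB ?orbT // andbT.
  rewrite cB ?inE ?eqxx ?yB ?orbT // andbT.
  by apply: contraNneq xB => <-.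
have xg B : x \in B -> g B = 0.
  move=> xB; apply: gL; rewrite in_dchains negb_and; apply/orP; left.
  by apply/chainsP => -[/subsetP/(_ x xB)]; rewrite !inE eqxx.
have gx B : g B != 0 -> {in B, forall y, comparable x y}.
  move=> /(proj1 (supportedP _ _) gL); rewrite in_dchains => /andP[/chainsP[BL _] _] y.
  by move=> /(subsetP BL)/Lx.
have agX : supported (add x g) (dchains X i.+1) by apply: supported_add gL.
pose f' B := f B + bd (add x g) B.
have f'X : supported f' (dchains X i).
  by move=> B BX; rewrite /f' fX // (bd_dchains agX) // addr0.
have df' : bd f' =1 (fun=> 0).
  by move=> B; rewrite bdD f0 (bd_bd (dchains_supported agX)) addr0.
(* [del x] anticommutes with [bd] and undoes [add x], so [del x f'] equals [del x f - bd g], which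
   is 0. *)
have f'x B : x \in B -> f' B = 0.
  move=> xB; suff : del x f' (B :\ x) = 0.
    rewrite /del setD11 setD1K // => /eqP; rewrite mulf_eq0.
    by rewrite signr_eq0 => /eqP.
  rewrite /f' delD (del_bd x _ (dchains_supported agX)) (eq_bd (del_add xg)).
  by rewrite gf subrr.
have [|h hX hf] := acX i f' _ df'.
  apply/supportedP => B f'B; move/supportedP/(_ B f'B): f'X.
  rewrite !in_dchains => /andP[/chainsP[BX cB] ->]; rewrite andbT.
  apply/chainsP; split=> //; apply/subsetP => y yB; rewrite !inE (subsetP BX) // andbT.
  by apply: contraNneq f'B => yx; rewrite f'x // -yx.
exists (fun B => h B - add x g B); last first.
  by move=> B; rewrite bdB hf addrK.
move=> B BX; rewrite agX // hX ?subr0 //; apply: contra BX.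
rewrite !in_dchains => /andP[+ ->]; rewrite andbT.
by apply: (subsetP (chains_mono (subsetDl X [set x]))).
Qed.

End OrderComplex.

(** * Smith theory *)

Section CyclicAction.

Local Open Scope ring_scope.

Context (k : fieldType) (p : nat) (I : finType) (T : I -> I).
Context (p_prime : prime p) (p_char : p%:R = 0 :> k).
Context (T_order : forall x, iter p T x = x).
Implicit Types (f g : I -> k) (S : {set I}).

Lemma cyclic_inj : injective T.
Proof.
move=> x y Txy; rewrite -(T_order x) -(T_order y) -(prednK (prime_gt0 p_prime)).
by rewrite !iterSr Txy.
Qed.

Lemma iter_modp i x : iter (i %% p) T x = iter i T x.
Proof.
rewrite [in RHS](divn_eq i p) addnC iterD; congr (iter _ T _).
by elim: (i %/ p)%N => //= j IHj; rewrite mulSn iterD -IHj T_order.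
Qed.

Lemma iter_fixed i x : T x = x -> iter i T x = x.
Proof. by move=> Tx; elim: i => //= i ->. Qed.

(** A coincidence at distance d with 0 < d < p makes [iter d T] fix x. Since d is prime to p, a
    Bezout relation u d = v p + 1 then forces T x = x. *)
Lemma free_orbit x i j : T x != x -> (i < p)%N -> (j < p)%N ->
  iter i T x = iter j T x -> i = j.
Proof.
wlog le_ij : i j / (i <= j)%N => [IH Tx ip jp eqij|].
  by case/orP: (leq_total i j) => [/IH|/IH H]; [apply | apply/esym/H].
move=> Tx ip jp; rewrite -(subnKC le_ij) iterD => /esym.
have iter_inj : injective (iter i T)
  by elim: i {le_ij ip} => //= i IHi y z /cyclic_inj/IHi.
move/iter_inj; case: (posnP (j - i)) => [-> _|d_gt0 Td]; first by rewrite addn0.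
set d := (j - i)%N in d_gt0 Td *.
have dp : coprime d p.
  rewrite coprime_sym prime_coprime //; apply: contraL jp => /(dvdn_leq d_gt0) pd.
  by rewrite -leqNgt (leq_trans pd) // leq_subr.
have Tdm m : iter (m * d) T x = x by elim: m => // m IHm; rewrite mulSn iterD IHm.
case/eqP: Tx; case: (egcdnP p d_gt0) => u v + _; rewrite (eqP dp) => uv.
have := Tdm u; rewrite uv addn1 iterS -[iter (v * p) T x]iter_modp modnMl.
exact.
Qed.

Lemma iter_free i x : (T (iter i T x) != iter i T x) = (T x != x).
Proof. by rewrite -iterS iterSr; elim: i => //= i; rewrite (inj_eq cyclic_inj). Qed.

(** A partition of unity on the free orbits: [m] is the indicator of one representative, given by
    [froot T], in each orbit of length p. *)
Lemma free_orbit_transversal : exists m : I -> k, forall x,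
  \sum_(i < p) m (iter i T x) = (T x != x)%:R.
Proof.
exists (fun x => ((T x != x) && (froot T x == x))%:R) => x.
have [Tx|Tx] := boolP (T x != x); last first.
  by rewrite big1 // => i _; rewrite iter_free (negPf Tx).
have sym := fconnect_sym cyclic_inj.
have eq_i0 : exists i0 : 'I_p, iter i0 T x = froot T x.
  have ltp : (findex T x (froot T x) %% p < p)%N by rewrite ltn_mod prime_gt0.
  by exists (Ordinal ltp); rewrite iter_modp iter_findex // connect_root.
case: eq_i0 => i0 i0P.
have rooti i : froot T (iter i T x) = froot T x.
  by apply/esym/eqP; rewrite root_connect // fconnect_iter.
rewrite (bigD1 i0) //= iter_free Tx rooti i0P eqxx big1 ?addr0 // => i ii0.
rewrite rooti iter_free Tx -i0P; case: eqP => // /(free_orbit Tx) /= eq_i.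
by case/eqP: ii0; apply/val_inj/esym/eq_i.
Qed.

(** The two Smith operators, 1 - T for [true] and the norm 1 + T + ... + T^(p-1) for [false]. The
    flag lets one argument treat both, [~~ b] being the complementary operator. *)
Definition smith_op (b : bool) f x : k :=
  if b then f x - f (T x) else \sum_(i < p) f (iter i T x).

Lemma smith_opD b f g x :
  smith_op b (fun y => f y + g y) x = smith_op b f x + smith_op b g x.
Proof. by case: b => /=; rewrite ?big_split // opprD addrACA. Qed.

Lemma smith_opN b f x : smith_op b (fun y => - f y) x = - smith_op b f x.
Proof. by case: b => /=; rewrite ?sumrN // opprD. Qed.

Lemma eq_smith_op b f g : f =1 g -> smith_op b f =1 smith_op b g.
Proof. by move=> fg x; case: b => /=; rewrite ?fg //; apply: eq_bigr. Qed.

(** At a fixed point the norm is p times [f x], which is 0 in characteristic p. *)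
Lemma smith_op_fixed b f x : T x = x -> smith_op b f x = 0.
Proof.
move=> Tx; case: b => /=; first by rewrite Tx subrr.
rewrite (eq_bigr (fun=> f x)) => [|i _]; last by rewrite iter_fixed.
by rewrite sumr_const card_ord -mulr_natr p_char mulr0.
Qed.

Lemma smith_op_fixed_support b f : (forall x, T x != x -> f x = 0) ->
  smith_op b f =1 (fun=> 0).
Proof.
move=> f0 x; have [Tx|Tx] := eqVneq (T x) x; first exact: smith_op_fixed.
case: b => /=; first by rewrite !f0 ?subrr // (iter_free 1).
by apply: big1 => i _; rewrite f0 // iter_free.
Qed.

Lemma smith_opK b f x : smith_op b (smith_op (~~ b) f) x = 0.
Proof.
have sum_shift y : \sum_(i < p) f (iter i T (T y)) = \sum_(i < p) f (iter i T y).
  have [q pq] : exists q, p = q.+1 by exists p.-1; rewrite prednK ?prime_gt0.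
  have /(congr1 f) := T_order y; rewrite pq => Ty.
  rewrite big_ord_recr [RHS]big_ord_recl /= -iterSr Ty addrC; congr (_ + _).
  by apply: eq_bigr => i _; rewrite -iterSr.
case: b => /=; first by rewrite sum_shift subrr.
rewrite sumrB -sum_shift; apply/eqP; rewrite subr_eq0; apply/eqP/eq_bigr => i _.
by rewrite -iterSr.
Qed.

(* With h i x = m x * f (T^(p-i) x), the f-weighted partition of unity gives
   f = sum_i (h i o T^i), which telescopes to m * sigma f modulo tau. *)
Lemma smith_op_exact b f S : (forall x, (T x \in S) = (x \in S)) ->
  (forall x, x \notin S -> f x = 0) -> smith_op b f =1 (fun=> 0) ->
  exists2 g, (forall x, x \notin S -> g x = 0) &
    forall x, T x != x -> f x = smith_op (~~ b) g x.
Proof.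
move=> TS fS f0; have [m sum_m] := free_orbit_transversal.
have TiS i x : (iter i T x \in S) = (x \in S) by elim: i => //= i; rewrite TS.
case: b f0 => /= f0.
  (* Here [f] is constant on orbits, so the norm of [m * f] is [f] times the sum of [m] over the
     orbit. *)
  exists (fun x => m x * f x) => [x /fS->|x Tx]; first by rewrite mulr0.
  have fi i : f (iter i T x) = f x.
    by elim: i => // i <-; apply/esym/eqP; rewrite -subr_eq0; apply/eqP/f0.
  rewrite (eq_bigr (fun i : 'I_p => m (iter i T x) * f x)) => [|i _]; last by rewrite fi.
  by rewrite -mulr_suml sum_m Tx mul1r.
pose h i x := m x * f (iter (p - i) T x).
exists (fun x => - \sum_(i < p) \sum_(l < i) h i (iter l T x)).
  move=> x xS; rewrite big1 ?oppr0 // => i _; apply: big1 => l _.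
  by rewrite /h fS ?mulr0 // !TiS.
move=> x Tx; rewrite opprK addrC -sumrB.
rewrite (eq_bigr (fun i : 'I_p => h i (iter i T x) - h i x)) => [|i _]; last first.
  under eq_bigr do rewrite -iterSr.
  rewrite -sumrB -(big_mkord xpredT (fun l => h i (iter l.+1 T x) - h i (iter l T x))).
  by rewrite telescope_sumr.
rewrite sumrB -mulr_sumr.
(* The exponent p - i runs over 1, ..., p, so this is the norm of [f] at [T x]. *)
have -> : \sum_(i < p) f (iter (p - i) T x) = 0.
  rewrite -[RHS](f0 (T x)) /smith_op [LHS](reindex_inj rev_ord_inj) /=.
  by apply: eq_bigr => i _; rewrite subKn // -iterSr.
rewrite mulr0 subr0 (eq_bigr (fun i : 'I_p => m (iter i T x) * f x)) => [|i _].
  by rewrite -mulr_suml sum_m Tx mul1r.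
by rewrite /h -iterD subnK ?T_order // ltnW.
Qed.

End CyclicAction.

(** * Poset automorphisms acting on chains *)

Section OrderAction.

Local Open Scope ring_scope.

Context (k : fieldType) (U : finType) (lt : rel U).
Context (lt_irr : irreflexive lt) (lt_trans : transitive lt).
Context (t : {perm U}) (t_mono : {mono t : x y / lt x y}).
Context (X : {set U}) (tX : forall x, (t x \in X) = (x \in X)).
Implicit Types (x y : U) (B : {set U}) (f g : {set U} -> k).

Lemma imset_chains B : (t @: B \in chains lt X) = (B \in chains lt X).
Proof.
apply/chainsP/chainsP => -[BX cB]; split.
- by apply/subsetP => x xB; rewrite -tX (subsetP BX) ?imset_f.
- move=> x y xB yB; have := cB _ _ (imset_f t xB) (imset_f t yB).
  by rewrite /comparable !t_mono (inj_eq perm_inj).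
- by apply/subsetP => _ /imsetP[x xB ->]; rewrite tX (subsetP BX).
move=> _ _ /imsetP[x xB ->] /imsetP[y yB ->].
by rewrite /comparable !t_mono (inj_eq perm_inj); apply: cB.
Qed.

Lemma imset_dchains i B : (t @: B \in dchains lt X i) = (B \in dchains lt X i).
Proof. by rewrite !in_dchains imset_chains card_imset //; apply: perm_inj. Qed.

Lemma sgn_imset x B : sgn k lt (t x) (t @: B) = sgn k lt x B.
Proof.
rewrite /sgn -(card_imset (mem [set y in B | lt y x]) (@perm_inj _ t)).
congr (_ ^+ _); apply: eq_card => y; rewrite inE.
apply/andP/imsetP => [[/imsetP[z zB ->]]|[z]].
  by rewrite t_mono => zx; exists z; rewrite // inE zB.
by rewrite inE => /andP[zB zx] ->; rewrite t_mono imset_f.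
Qed.

Lemma bd_imset f B : bd lt (fun B => f (t @: B)) B = bd lt f (t @: B).
Proof.
rewrite /bd [RHS](reindex_inj (@perm_inj _ t)); apply: eq_bigr => x _.
by rewrite /del sgn_imset imsetU1 (mem_imset _ _ perm_inj).
Qed.

(** If x < t x, then x < t x < t^2 x < ... eventually returns to x, a contradiction; likewise for x
    > t x. A stable chain contains both x and t x, which are comparable, hence equal. So the fixed
    simplices of the order complex are the simplices of the fixed poset. *)
Lemma fixed_chain B : B \in chains lt X -> t @: B = B -> {in B, forall x, t x = x}.
Proof.
move=> /chainsP[_ cB] tB x xB; have txB : t x \in B by rewrite -tB imset_f.
have iter_t : iter #[t]%g t x = x by rewrite -permX expg_order perm1.
have no_lt (r : rel U) : irreflexive r -> transitive r ->
    {mono t : x y / r x y} -> r x (t x) = false.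
  move=> r_irr r_trans r_mono; apply/negP => xtx.
  have r_iter i : r x (iter i.+1 t x).
    elim: i => //= i IHi; apply: r_trans xtx _.
    by rewrite r_mono.
  by have := r_iter #[t]%g.-1; rewrite prednK ?order_gt0 // iter_t r_irr.
case/or3P: (cB _ _ xB txB) => [/eqP <- //|xtx|xtx].
  by rewrite no_lt in xtx.
have gt_trans : transitive (fun x y => lt y x) by move=> y z u /[swap]; apply: lt_trans.
by have := no_lt (fun x y => lt y x) lt_irr gt_trans (fun x y => t_mono y x); rewrite xtx.
Qed.

Lemma fixed_dchains i B : B \in dchains lt X i -> t @: B = B ->
  B \in dchains lt [set x in X | t x == x] i.
Proof.
rewrite !in_dchains => /andP[BX ->] tB; rewrite andbT; have tx := fixed_chain BX tB.
case/chainsP: BX => BX cB; apply/chainsP; split=> //; apply/subsetP => x xB.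
by rewrite inE (subsetP BX) //= tx.
Qed.

Section Smith.

Context (p : nat) (p_prime : prime p) (p_char : p%:R = 0 :> k).
Context (t_order : forall x, iter p t x = x).

Let T B := t @: B.

Let iterT i B : iter i T B = iter i t @: B.
Proof.
elim: i => [|i IHi] /=; first by rewrite imset_id.
by rewrite IHi /T -imset_comp.
Qed.

Let T_order B : iter p T B = B.
Proof. by rewrite iterT (eq_imset (g := id)) ?imset_id. Qed.

Let T_dchains i B : (T B \in dchains lt X i) = (B \in dchains lt X i).
Proof. exact: imset_dchains. Qed.

Let iterT_dchains j i B : (iter j T B \in dchains lt X i) = (B \in dchains lt X i).
Proof. by elim: j => //= j; rewrite T_dchains. Qed.

Lemma bd_smith_op b f B : bd lt (smith_op p T b f) B = smith_op p T b (bd lt f) B.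
Proof.
case: b => /=; first by rewrite bdB bd_imset.
have bd_iter j C : bd lt (fun C => f (iter j T C)) C = bd lt f (iter j T C).
  elim: j C => //= j IHj C; rewrite -iterS iterSr -IHj -bd_imset.
  by apply: eq_bd => D; rewrite -iterS iterSr.
rewrite [LHS](eq_bigr _ (fun x _ => del_sum lt x _ B)) exchange_big /=.
by apply: eq_bigr => i _; rewrite -bd_iter.
Qed.

Lemma smith_op_supported b f i : supported f (dchains lt X i) ->
  supported (smith_op p T b f) (dchains lt X i).
Proof.
move=> fX B BX; case: b => /=; first by rewrite !fX ?subrr // T_dchains.
by apply: big1 => j _; rewrite fX // iterT_dchains.
Qed.

(* Let sigma = 1 + t + ... + t^(p-1) and tau = 1 - t act on the chains V of X.
   If {alpha, beta} = {sigma, tau}, then 0 -> k[Y] + beta V -> V -> alpha V -> 0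
   is exact, where Y is the fixed poset; as V is acyclic, the homology of k[Y] in
   degree i embeds in that of alpha V in degree i + 1, and descending induction
   on i kills both. *)
Lemma smith_acyclic : acyclic k lt X -> acyclic k lt [set x in X | t x == x].
Proof.
set Y := [set x in X | _] => acX.
have TB0 B : T B != B -> forall i, B \notin dchains lt Y i.
  move=> TB i; rewrite in_dchains; apply: contra TB => /andP[/chainsP[BY _] _].
  rewrite -{2}[B]imset_id; apply/eqP/eq_in_imset => x /(subsetP BY).
  by rewrite inE => /andP[_ /eqP].
have YX i : dchains lt Y i \subset dchains lt X i.
  apply/subsetP => B; rewrite !in_dchains => /andP[BY ->]; rewrite andbT.
  by apply: subsetP BY; apply: chains_mono; apply/subsetP => x; rewrite inE => /andP[].
(* Here beta is [smith_op p T b] and alpha is [smith_op p T (~~ b)]. A primitive v of w + beta u has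
   alpha v a cycle; the hypothesis one degree up writes alpha v = bd (alpha v'). Then q = v - bd v'
   is killed by alpha, so exactness splits it as w' + beta g, with w' on the fixed chains. *)
have step i :
    (forall b (u : {set U} -> k), supported u (dchains lt X i.+1) ->
       bd lt (smith_op p T b u) =1 (fun=> 0) ->
     exists2 u', supported u' (dchains lt X i.+2) &
       bd lt (smith_op p T b u') =1 smith_op p T b u) ->
    forall b (w u : {set U} -> k),
      supported w (dchains lt Y i) -> supported u (dchains lt X i) ->
      bd lt (fun B => w B + smith_op p T b u B) =1 (fun=> 0) ->
    exists w' u', [/\ supported w' (dchains lt Y i.+1), supported u' (dchains lt X i.+1),
       bd lt w' =1 w & bd lt (smith_op p T b u') =1 smith_op p T b u].
  move=> IH b w u wY uX wu0.
  have wuX : supported (fun B => w B + smith_op p T b u B) (dchains lt X i).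
    move=> B BX; rewrite /= (smith_op_supported b uX) // addr0 wY //.
    by apply: contra BX; apply: subsetP.
  have [v vX vwu] := acX _ _ wuX wu0.
  have [|v' v'X vv'] := IH (~~ b) v vX.
    move=> B; rewrite bd_smith_op (eq_smith_op p T (~~ b) vwu) smith_opD.
    rewrite (smith_op_fixed_support p_prime p_char T_order) ?add0r.
      by rewrite -[X in smith_op _ _ _ (smith_op _ _ X _)]negbK smith_opK.
    by move=> C /TB0/(_ i)/wY.
  pose q B := v B - bd lt v' B.
  have qX : supported q (dchains lt X i.+1).
    by move=> B BX; rewrite /q vX // (bd_dchains v'X) // subr0.
  have q0 : smith_op p T (~~ b) q =1 (fun=> 0).
    by move=> B; rewrite smith_opD smith_opN -bd_smith_op vv' subrr.
  have bdq B : bd lt q B = w B + smith_op p T b u B.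
    rewrite bdB vwu (bd_bd lt_irr lt_trans (dchains_supported v'X)) ?subr0 //.
  have [g gX qg] := smith_op_exact p_prime T_order (T_dchains i.+1) qX q0.
  rewrite negbK in qg.
  pose w' B := if T B == B then q B else 0.
  have w'Y : supported w' (dchains lt Y i.+1).
    apply/supportedP => B; rewrite /w'; case: (T B =P B) => [TB|_]; last by rewrite eqxx.
    by move=> /(proj1 (supportedP _ _) qX)/fixed_dchains; apply.
  have q_eq B : q B = w' B + smith_op p T b g B.
    rewrite /w'; case: eqP => [TB|/eqP /qg ->]; last by rewrite add0r.
    by rewrite smith_op_fixed // addr0.
  (* Compare chain by chain: at a fixed chain both sides vanish, and elsewhere w and bd w'
     vanish. *)
  have bdg : bd lt (smith_op p T b g) =1 smith_op p T b u.
    move=> B; have [TB|TB] := eqVneq (T B) B.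
      by rewrite bd_smith_op !smith_op_fixed.
    have := bdq B; rewrite (eq_bd lt q_eq) bdD.
    by rewrite (bd_dchains w'Y) ?TB0 // wY ?TB0 // !add0r.
  exists w', g; split=> // B; apply: (addIr (smith_op p T b u B)).
  by rewrite -bdq (eq_bd lt q_eq) bdD bdg.
(* Descending induction on the degree i, in the form of an induction on n. It starts above degree
   [#|U|], where there are no chains. *)
have bound n i : (#|U| < i + n)%N ->
     forall b (u : {set U} -> k), supported u (dchains lt X i) ->
       bd lt (smith_op p T b u) =1 (fun=> 0) ->
     exists2 u', supported u' (dchains lt X i.+1) &
       bd lt (smith_op p T b u') =1 smith_op p T b u.
  elim: n i => [|n IHn] i lti b u uX u0.
    have u_eq0 B : u B = 0.
      apply: uX; rewrite in_dchains negb_and; apply/orP; right.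
      by rewrite neq_ltn (leq_ltn_trans (max_card _)) // -[i]addn0.
    have op0 : smith_op p T b u =1 fun=> 0 by apply: smith_op_fixed_support.
    exists u; first by move=> B _.
    by move=> B; rewrite u0 op0.
  have IH := IHn i.+1; rewrite addSnnS in IH.
  have w0 : supported (fun=> 0 : k) (dchains lt Y i) by [].
  have [|_ [u' [_ u'X _ u'u]]] := step i (IH lti) b _ u w0 uX; last by exists u'.
  by move=> B; rewrite bdD u0 bd0 ?addr0.
move=> i f fY f0; have u0 : supported (fun=> 0 : k) (dchains lt X i) by [].
have IH : (#|U| < i.+1 + #|U|)%N by rewrite ltnS leq_addl.
have [|w' [_ [w'Y _ w'f _]]] := step i (bound _ _ IH) true f _ fY u0; last by exists w'.
move=> B; rewrite bdD f0 bd0 ?addr0 // => C.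
by rewrite (smith_op_fixed_support p_prime p_char T_order).
Qed.
End Smith.
End OrderAction.

(** * The Lefschetz formula *)

Section MatrixTrace.

Local Open Scope ring_scope.

(* A generalized inverse P of D gives the homotopy 1 = D P + (1 - D P) P D. *)
Lemma mxtrace_exact_anticomm (k : fieldType) (n : nat) (D M : 'M[k]_n) :
  D *m D = 0 -> (kermx D <= D)%MS -> M *m D = - (D *m M) -> \tr M = 0.
Proof.
move=> DD kerD MD; pose P := pinvmx D; pose Q := (1%:M - D *m P) *m P.
have DPD : D *m P *m D = D by apply: mulmxKpV.
(* The rows of 1 - D P are killed by D, so by exactness they lie in the row space of D. *)
have QD : Q *m D = 1%:M - D *m P.
  apply: mulmxKpV; apply: submx_trans kerD; apply/sub_kermxP.
  by rewrite mulmxBl mul1mx DPD subrr.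
(* With 1 = Q D + D P, the trace of M is tr (M Q D) + tr (M D P). Cyclicity and anticommutation make
   the first term -tr (M D Q), and D D = 0 turns M D Q into M D P. *)
have trMQD : \tr (M *m (Q *m D)) = - \tr (M *m D *m Q).
  by rewrite mulmxA mxtrace_mulC mulmxA MD mulNmx raddfN opprK.
have MDQ : M *m D *m Q = M *m D *m P.
  rewrite /Q mulmxA mulmxBr mulmx1 [M *m D *m (D *m P)]mulmxA.
  by rewrite -[M *m D *m D]mulmxA DD mulmx0 mul0mx subr0.
rewrite -[M in LHS]mulmx1 -[1%:M](subrK (D *m P)) -QD mulmxDr raddfD /=.
by rewrite trMQD MDQ mulmxA addNr.
Qed.

End MatrixTrace.

Section Lefschetz.

Local Open Scope ring_scope.

Context (k : fieldType) (U : finType) (lt : rel U).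
Context (lt_irr : irreflexive lt) (lt_trans : transitive lt).
Context (X : {set U}).
Implicit Types (B C : {set U}) (f g : {set U} -> k).

Lemma bd_linear (I : finType) (c : I -> k) (F : I -> {set U} -> k) B :
  bd lt (fun B => \sum_i c i * F i B) B = \sum_i c i * bd lt (F i) B.
Proof.
rewrite [LHS](eq_bigr _ (fun x _ => del_sum lt x _ B)) exchange_big /=.
apply: eq_bigr => i _; rewrite mulr_sumr; apply: eq_bigr => x _.
by rewrite /del; case: ifP => _; rewrite ?mulr0 // mulrCA.
Qed.

Let S := chains lt X.
Let e (i : 'I_#|S|) : {set U} := enum_val i.
Let dirac B C : k := (B == C)%:R.

(** Rows are the images of the basis functions, so operators act on row vectors from the right and
    matrix products compose in reverse order. *)
Let chain_mx (L : ({set U} -> k) -> {set U} -> k) : 'M[k]_#|S| :=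
  \matrix_(i, j) L (dirac (e i)) (e j).

Let fun_of_row (u : 'rV[k]_#|S|) B : k := \sum_i u 0 i * dirac (e i) B.

Let fun_of_rowE u i : fun_of_row u (e i) = u 0 i.
Proof.
rewrite /fun_of_row (bigD1 i) //= /dirac eqxx mulr1 big1 ?addr0 // => j ji.
by rewrite (inj_eq enum_val_inj) (negPf ji) mulr0.
Qed.

Let fun_of_row_supported u : supported (fun_of_row u) S.
Proof.
move=> B BS; apply: big1 => i _; rewrite /dirac.
by case: eqP BS => [<-|]; rewrite ?mulr0 // enum_valP.
Qed.

Let fun_of_rowK f : supported f S -> fun_of_row (\row_i f (e i)) =1 f.
Proof.
move=> fS B; case: (boolP (B \in S)) => [BS|BS]; last first.
  by rewrite fun_of_row_supported // fS.
by rewrite -(enum_rankK_in BS BS) fun_of_rowE mxE.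
Qed.

Let dirac_supported i : supported (dirac (e i)) S.
Proof. by move=> B; rewrite /dirac; case: eqP => // <-; rewrite enum_valP. Qed.

Definition linear_op (L : ({set U} -> k) -> {set U} -> k) :=
  (forall f g, f =1 g -> L f =1 L g) /\
  (forall n (c : 'I_n -> k) F B,
     L (fun B => \sum_i c i * F i B) B = \sum_i c i * L (F i) B).

Let mul_chain_mx L u : linear_op L ->
  u *m chain_mx L = \row_j L (fun_of_row u) (e j).
Proof.
move=> [_ L_lin]; apply/rowP => j; rewrite !mxE L_lin.
by apply: eq_bigr => i _; rewrite !mxE.
Qed.

Let chain_mxM L L' : linear_op L' -> (forall f, supported f S -> supported (L f) S) ->
  chain_mx L *m chain_mx L' = chain_mx (L' \o L).
Proof.
move=> L'_lin LS; apply/row_matrixP => i; rewrite row_mul mul_chain_mx //.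
apply/rowP => j; rewrite !mxE; apply: (proj1 L'_lin) => B.
rewrite -(fun_of_rowK (LS _ (dirac_supported i))).
by congr (fun_of_row _ B); apply/rowP => l; rewrite !mxE.
Qed.

Let bd_supported f : supported f S -> supported (bd lt f) S.
Proof. by move=> fS B BS; apply: big1 => x _; apply: del_supported BS. Qed.

(** [acyclic] only concerns homogeneous cycles. Since [bd] lowers the degree by one, every
    homogeneous part of a cycle is a cycle, and primitives of the parts add up. *)
Lemma acyclic_total f : acyclic k lt X -> supported f S -> bd lt f =1 (fun=> 0) ->
  exists2 g, supported g S & bd lt g =1 f.
Proof.
move=> acX fS f0; pose fd i B := if #|B| == i then f B else 0.
have fdS i : supported (fd i) (dchains lt X i).
  move=> B; rewrite in_dchains /fd; case: ifP => // _; rewrite andbT; apply: fS.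
have fd0 i : bd lt (fd i) =1 fun=> 0.
  move=> B; have [Bi|Bi] := eqVneq #|B|.+1 i; rewrite -?[RHS](f0 B).
    apply: eq_bigr => x _; rewrite /del /fd; case: ifP => // xB.
    by rewrite cardsU1 xB -Bi eqxx.
  rewrite f0; apply: big1 => x _; rewrite /del /fd; case: ifP => // xB.
  by rewrite cardsU1 xB (negPf Bi) mulr0.
have /fin_all_exists[g gP] : forall i : 'I_#|U|.+1, exists g,
    supported g (dchains lt X i.+1) /\ bd lt g =1 fd i.
  by move=> i; have [g gS gf] := acX i _ (fdS i) (fd0 i); exists g.
exists (fun B => \sum_(i < #|U|.+1) 1 * g i B).
  move=> B BS; apply: big1 => i _.
  by rewrite (proj1 (gP i)) ?mulr0 // in_dchains (negPf BS).
move=> B; rewrite bd_linear.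
have Bs : (#|B| < #|U|.+1)%N by rewrite ltnS max_card.
rewrite (bigD1 (Ordinal Bs)) //= mul1r (proj2 (gP _)) /fd eqxx big1 ?addr0 // => i.
by rewrite mul1r (proj2 (gP i)) /fd -val_eqE eq_sym => /negPf ->.
Qed.

(** The sum includes the empty chain, so it is 1 minus the Euler characteristic of the fixed poset.
    The degree sign in [mu] makes the action of t anticommute with [bd], so its trace on an exact
    complex is 0; by [fixed_chain] that trace is the sum on the left. *)
Lemma lefschetz (t : {perm U}) : {mono t : x y / lt x y} ->
  (forall x, (t x \in X) = (x \in X)) -> acyclic k lt X ->
  \sum_(B in chains lt [set x in X | t x == x]) (-1) ^+ #|B| = 0 :> k.
Proof.
move=> t_mono tX acX; pose mu f B : k := (-1) ^+ #|B| * f (t @: B).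
have bd_lin : linear_op (bd lt (k := k)).
  by split=> [f g|n c F B]; [apply: eq_bd | apply: bd_linear].
have mu_lin : linear_op mu.
  split=> [f g fg B|n c F B]; first by rewrite /mu fg.
  by rewrite /mu mulr_sumr; apply: eq_bigr => i _; rewrite mulrCA.
have mu_S f : supported f S -> supported (mu f) S.
  by move=> fS B BS; rewrite /mu fS ?mulr0 // imset_chains.
have := @mxtrace_exact_anticomm k _ (chain_mx (bd lt (k := k))) (chain_mx mu).
have -> : \tr (chain_mx mu) =
    \sum_(B in chains lt [set x in X | t x == x]) (-1) ^+ #|B|.
  rewrite /mxtrace (eq_bigr (fun i => (-1) ^+ #|e i| * (e i == t @: e i)%:R)); last first.
    by move=> i _; rewrite mxE.
  rewrite -(big_enum_val (idx := 0) (fun B => (-1) ^+ #|B| * (B == t @: B)%:R)).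
  rewrite (big_setID (chains lt [set x in X | t x == x])) /= [X in _ + X]big1 ?addr0.
    rewrite (setIidPr _); last first.
      by apply: chains_mono; apply/subsetP => x; rewrite inE => /andP[].
    apply: eq_bigr => B /chainsP[BX _]; rewrite [t @: B](_ : _ = B) ?eqxx ?mulr1 //.
    rewrite -[RHS]imset_id; apply: eq_in_imset => x /(subsetP BX).
    by rewrite inE => /andP[_ /eqP].
  move=> B /setDP[BS]; case: eqP => [tB|]; last by rewrite mulr0.
  have := @fixed_dchains _ _ lt_irr lt_trans _ t_mono X #|B| B.
  by rewrite !in_dchains BS eqxx !andbT => -> //.
apply.
- rewrite chain_mxM //; apply/matrixP => i j; rewrite !mxE /=.
  by rewrite (bd_bd lt_irr lt_trans (@dirac_supported i)).
- apply/row_subP => i; set u := row i _.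
  have /sub_kermxP : (u <= kermx (chain_mx (bd lt (k := k))))%MS by apply: row_sub.
  rewrite mul_chain_mx // => u0.
  have [|g gS gu] := acyclic_total acX (@fun_of_row_supported u).
    move=> B; case: (boolP (B \in S)) => [BS|]; last exact: bd_supported.
    have /rowP/(_ (enum_rank_in BS B)) := u0.
    by rewrite !mxE /e enum_rankK_in.
  apply/submxP; exists (\row_i g (e i)); rewrite mul_chain_mx //.
  apply/rowP => j; rewrite mxE (eq_bd lt (fun_of_rowK gS)) gu.
  by rewrite fun_of_rowE.
rewrite !chain_mxM //; apply/matrixP => i j; rewrite !mxE /=.
rewrite {2}/mu -(bd_imset t_mono) /bd mulr_sumr -sumrN; apply: eq_bigr => x _.
rewrite /del; case: ifP => xB; rewrite ?mulr0 ?oppr0 //.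
by rewrite /mu cardsU1 xB exprS mulN1r mulNr mulrN mulrCA.
Qed.

End Lefschetz.

(** * Nonevasive properties *)

Definition properset (T : finType) (A B : {set T}) := A \proper B.

Lemma properset_irr (T : finType) : irreflexive (@properset T).
Proof. by move=> A; apply: properxx. Qed.

Lemma properset_trans (T : finType) : transitive (@properset T).
Proof. by move=> B A C; apply: proper_trans. Qed.

Lemma subset_comparable (T : finType) (A B : {set T}) :
  A \subset B -> comparable (@properset T) A B.
Proof.
by move=> AB; rewrite /comparable /properset !properEneq eq_sym AB; case: eqVneq.
Qed.

Section Nonevasive.

Context (k : fieldType) (E : finType) (P : {set {set E}}).
Context (P_down : forall A B : {set E}, B \subset A -> A \in P -> B \in P).
Implicit Types (A B I J : {set E}) (D : {set {set E}}).

Let acyc := acyclic k (@properset E).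

(** For [I] in [P] this is, up to removing [I] from each member, the poset of nonempty faces of the
    link of [I] in the restriction of [P] to [J]. It models the state of a search where [I] is known
    present and the complement of [J] known absent. *)
Definition faces I J := [set A in P | (I \proper A) && (A \subset J)].

Lemma facesE I J A : (A \in faces I J) = [&& A \in P, I \proper A & A \subset J].
Proof. by rewrite inE. Qed.

(** The poset is built from the deletion [F0] by adding the points of [F1] from the top down, each
    with a contractible link, and finally the point [e |: I], whose link is exactly [F1]. *)
Lemma faces_glue e I J : e \in J -> e \notin I -> e |: I \in P ->
  acyc (faces I (J :\ e)) -> acyc (faces (e |: I) J) -> I \subset J -> acyc (faces I J).
Proof.
set F0 := faces I _; set F1 := faces _ J => eJ eI IP ac0 ac1 IJ.
have lt_irr := @properset_irr E; have lt_trans := @properset_trans E.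
have F0e A : A \in F0 -> e \notin A.
  by rewrite facesE subsetD1 => /and4P[].
have F1e A : A \in F1 -> e \in A.
  by rewrite facesE => /and3P[_ /proper_sub/subsetP/(_ e)]; rewrite setU11 => ->.
have up n D : #|D| <= n -> D \subset F1 ->
    (forall A B, A \in D -> B \in F1 -> A \subset B -> B \in D) -> acyc (F0 :|: D).
  elim: n D => [|n IHn] D Dn DF Dup.
    by move: Dn; rewrite leqn0 cards_eq0 => /eqP->; rewrite setU0.
  have [->|[A0 A0D]] := set_0Vmem D; first by rewrite setU0.
  (* For A of least size in D, the members of [F0] comparable to A are contained in [A :\ e] and
     those of D contain A. So the link of A is a cone with apex [A :\ e]. *)
  case: (@arg_minnP _ A0 (mem D) (fun A => #|A|) A0D) => A /= AD Amin.
  have AF1 := subsetP DF _ AD; have eA := F1e A AF1.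
  have DA : (F0 :|: D) :\ A = F0 :|: D :\ A.
    rewrite setDUl; congr (_ :|: _); apply/setDidPl; rewrite disjoint_sym disjoints1.
    by apply: contraL eA; apply: F0e.
  apply: (point_acyclic lt_irr lt_trans (x := A)); first by rewrite inE AD orbT.
    rewrite DA; apply: IHn; last 1 first.
    - move=> B C /setD1P[BA BD] CF BC; rewrite !inE (Dup B C) // andbT.
      apply: contraNneq BA => CA; rewrite CA in BC.
      by rewrite eqEcard BC Amin.
    - by move: Dn; rewrite (cardsD1 A) AD ltnS.
    - exact: subset_trans (subsetDl _ _) DF.
  have AeF0 : A :\ e \in F0.
    move: AF1; rewrite !facesE => /and3P[AP IA AJ].
    rewrite (P_down (subsetDl _ _) AP) /= setSD // andbT.
    rewrite -[I](setU1K eI); apply/properP; split; first exact/setSD/proper_sub.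
    case/properP: IA => _ [x xA]; rewrite !inE negb_or => /andP[xe xI].
    by exists x; rewrite !inE ?xe // (negPf xe) (negPf xI).
  rewrite DA; apply: (cone_acyclic lt_irr lt_trans (a := A :\ e)).
    rewrite !inE -facesE AeF0 /= comparableC; apply: subset_comparable.
    exact: subsetDl.
  move=> B; rewrite 2!inE => /andP[/orP[BF0|/setD1P[BA BD]] AB].
    have eB := F0e B BF0; case/or3P: AB => [/eqP AB|/proper_sub/subsetP/(_ e eA)|BA].
    - by rewrite AB (negPf eB) in eA.
    - by rewrite (negPf eB).
    rewrite comparableC; apply: subset_comparable.
    by rewrite subsetD1 eB (proper_sub BA).
  apply: subset_comparable; apply: subset_trans (subsetDl _ _) _.
  case/or3P: AB => [/eqP->//|/proper_sub//|/proper_card].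
  by rewrite ltnNge Amin.
have X_eq : faces I J :\ (e |: I) = F0 :|: F1.
  apply/setP => A; rewrite !inE subsetD1.
  case: (boolP (e \in A)) => eA /=; rewrite ?andbF ?andbT ?orbF /=.
    rewrite !properEneq subUset sub1set eA /= (eq_sym A).
    case: (eqVneq (e |: I) A) => _ /=; first by rewrite andbF.
    suff -> : I != A by [].
    by apply: contraNneq eI => ->.
  have -> /= : (e |: I \proper A) = false.
    by apply/negP => /proper_sub/subsetP/(_ e); rewrite setU11 (negPf eA) => /(_ isT).
  rewrite andbF orbF; have [AI|//] := eqVneq A (e |: I).
  by rewrite AI setU11 in eA.
apply: (point_acyclic lt_irr lt_trans (x := e |: I)).
- by rewrite facesE IP subUset sub1set eJ IJ properUr // sub1set.
- by rewrite X_eq; apply: up (leqnn _) _ _ => // A B _.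
have -> // : [set A in faces I J :\ (e |: I) | comparable (@properset E) (e |: I) A] = F1.
rewrite X_eq; apply/setP => A; rewrite !inE -!facesE -/F0 -/F1.
apply/andP/idP => [[/orP[AF0 /or3P[/eqP IA|/proper_sub/subsetP/(_ e)|AI]|//]]|AF1].
- by have := F0e A AF0; rewrite -IA setU11.
- by rewrite setU11 (negPf (F0e A AF0)) => /(_ isT).
- move: AF0 (AI); rewrite facesE => /and3P[_ IA _] /proper_card.
  by rewrite cardsU1 eI ltnS leqNgt (proper_card IA).
split; first by rewrite AF1 orbT.
by apply: subset_comparable; move: AF1; rewrite facesE => /and3P[_ /proper_sub].
Qed.

(** The invariant is that fewer questions remain than undecided elements of [J :\: I]. A leaf
    answers alike at [I] and at [J], so [J] lies in [P] and tops the poset, a cone. A question about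
    an undecided e leads to the deletion and the link of e. *)
Lemma decided_faces_acyclic (t : strategy E) I J : I \subset J -> I \in P ->
  (forall A, I \subset A -> A \subset J -> answer t A = (A \in P)) ->
  depth t < #|J :\: I| -> acyc (faces I J).
Proof.
elim: t I J => [b|e t0 IH0 t1 IH1] I J IJ IP dec.
  rewrite card_gt0 => JI.
  have JP : J \in P by rewrite -(dec J) //; have /= -> := dec I (subxx _) IJ.
  apply: (cone_acyclic (@properset_irr E) (@properset_trans E) (a := J)).
    rewrite facesE JP subxx andbT properEneq IJ andbT.
    by apply: contraNneq JI => ->; rewrite setDv.
  by move=> A; rewrite facesE comparableC => /and3P[_ _ /subset_comparable].
rewrite /= => ltd.
have [lt0 lt1] : depth t0 < #|J :\: I|.-1 /\ depth t1 < #|J :\: I|.-1.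
  by split; rewrite -ltnS prednK ?(leq_ltn_trans _ ltd) // ltnS ?leq_maxl ?leq_maxr.
have [eI|eI] := boolP (e \in I).
  apply: (IH1 I J) => //; last exact: leq_trans lt1 (leq_pred _).
  by move=> A IA AJ; rewrite -dec //= (subsetP IA).
have [eJ|eJ] := boolP (e \in J); last first.
  apply: (IH0 I J) => //; last exact: leq_trans lt0 (leq_pred _).
  move=> A IA AJ; rewrite -dec //=; case: ifP => // /(subsetP AJ).
  by rewrite (negPf eJ).
have cardJI : #|J :\: I|.-1 = #|(J :\: I) :\ e|.
  by rewrite (cardsD1 e (J :\: I)) !inE eI eJ.
have ac0 : acyc (faces I (J :\ e)).
  apply: IH0; rewrite ?subsetD1 ?IJ //.
    move=> A IA; rewrite subsetD1 => /andP[AJ eA].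
    by rewrite -dec //= (negPf eA).
  by rewrite setDDl setUC -setDDl -cardJI.
(* If [e |: I] is not in [P], monotonicity excludes every face containing e, and only the deletion
   is left. *)
have [eIP|eIP] := boolP (e |: I \in P); last first.
  rewrite (_ : faces I J = faces I (J :\ e)) //; apply/setP => A; rewrite !facesE subsetD1.
  case: (boolP (e \in A)) => eA; rewrite /= ?andbT // !andbF.
  apply/negP => /and3P[AP /proper_sub IA _]; case/negP: eIP.
  by apply: P_down AP; rewrite subUset sub1set eA.
apply: (faces_glue eJ) => //; apply: IH1 => //.
- by rewrite subUset sub1set eJ.
- by move=> A; rewrite subUset sub1set => /andP[eA IA] AJ; rewrite -dec //= eA.
by rewrite setUC -setDDl -cardJI.
Qed.

End Nonevasive.

Lemma depth_query_all (E : finType) (P : {set {set E}}) s B :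
  depth (query_all P s B) = size s.
Proof. by elim: s B => //= e s IHs B; rewrite !IHs maxnn. Qed.

Lemma complexity_le_card (E : finType) (P : {set {set E}}) : complexity P <= #|E|.
Proof.
rewrite /complexity; case: ex_minnP => m _; apply; apply/asboolP.
exists (query_all P (enum E) set0); split; last by rewrite depth_query_all -cardE.
move=> A; rewrite answer_query_all; congr (_ \in P).
by apply/setP => x; rewrite !inE mem_enum.
Qed.

Lemma nonevasive_acyclic (k : fieldType) (E : finType) (P : {set {set E}}) :
  (forall A B : {set E}, B \subset A -> A \in P -> B \in P) -> P != set0 ->
  complexity P != #|E| -> acyclic k (@properset E) (P :\ set0).
Proof.
move=> P_down /set0Pn[A AP] ltc.
have {ltc} : complexity P < #|E| by rewrite ltn_neqAle ltc complexity_le_card.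
rewrite /complexity; case: ex_minnP => m /asboolP[t [dec dt]] _ ltm.
have -> : P :\ set0 = faces P set0 setT.
  by apply/setP => B; rewrite facesE !inE subsetT andbT proper0 andbC.
apply: (decided_faces_acyclic P_down (t := t)).
- exact: sub0set.
- by apply: P_down AP; apply: sub0set.
- by move=> B _ _; apply: dec.
- by rewrite setD0 cardsT (leq_ltn_trans dt).
Qed.

Lemma card_edge n : #|{: edge n}| = 'C(n, 2).
Proof.
rewrite -[RHS](_ : #|[set A : {set 'I_n} | #|A| == 2]| = _); last first.
  by rewrite card_draws card_ord.
rewrite -(card_image (f := @ends n) val_inj); apply: eq_card => A; rewrite !inE.
apply/imageP/idP => [[e _ ->]|A2]; first exact: card_ends.
by exists (Edge A2).
Qed.

(** * The affine group acting on graphs *)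

Section OrderFixed.
Local Open Scope ring_scope.
Context (k : fieldType) (U : finType) (lt : rel U).
Context (lt_irr : irreflexive lt) (lt_trans : transitive lt).

(** One permutation at a time: since they commute, each preserves the subposet fixed by the others,
    where [smith_acyclic] applies. *)
Lemma smith_acyclic_seq (p : nat) (X : {set U}) (ts : seq {perm U}) :
  prime p -> p%:R = 0 :> k ->
  {in ts, forall t : {perm U}, [/\ {mono t : x y / lt x y},
     forall x, (t x \in X) = (x \in X) & forall x, iter p t x = x]} ->
  {in ts &, forall t u : {perm U}, forall x, t (u x) = u (t x)} ->
  acyclic k lt X -> acyclic k lt [set x in X | all (fun t : {perm U} => t x == x) ts].
Proof.
move=> p_prime p_char; elim: ts => [|t ts IH] ts_ok ts_comm acX.
  by rewrite (_ : [set x in X | _] = X) //; apply/setP => x; rewrite inE andbT.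
have [t_mono tX t_order] := ts_ok t (mem_head _ _).
pose Y := [set x in X | all (fun u : {perm U} => u x == x) ts].
have acY : acyclic k lt Y.
  apply: IH acX; first by move=> u uts; apply: ts_ok; rewrite inE uts orbT.
  by move=> u v uts vts; apply: ts_comm; rewrite inE ?uts ?vts orbT.
have tY x : (t x \in Y) = (x \in Y).
  rewrite !inE tX; congr (_ && _); apply: eq_in_all => u uts.
  by rewrite (ts_comm u t) ?inE ?eqxx ?uts ?orbT // (inj_eq perm_inj).
have := smith_acyclic lt_irr lt_trans t_mono tY p_prime p_char t_order acY.
congr (acyclic _ _ _); apply/setP => x; rewrite !inE /= -andbA; congr (_ && _).
exact: andbC.
Qed.

(** The only chains are the empty one and the singletons. *)
Lemma antichain_sum (X : {set U}) : {in X &, forall x y, comparable lt x y -> x = y} ->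
  \sum_(B in chains lt X) (-1) ^+ #|B| = 1 - #|X|%:R :> k.
Proof.
move=> anti.
have -> : chains lt X = set0 |: [set [set x] | x in X].
  apply/setP => B; rewrite !in_setU1; apply/chainsP/predU1P => [[BX cB]|].
    have [->|[x xB]] := set_0Vmem B; first by left.
    right; apply/imsetP; exists x; first exact: subsetP xB.
    apply/eqP; rewrite eqEsubset sub1set xB andbT; apply/subsetP => y yB.
    by rewrite inE; apply/eqP/anti; rewrite ?(subsetP BX) ?cB.
  case=> [->|/imsetP[x xX ->]]; first by split; [apply: sub0set | move=> x y; rewrite inE].
  split; first by rewrite sub1set.
  by move=> _ _ /set1P-> /set1P->; rewrite /comparable eqxx.
rewrite big_setU1 /=; last by apply/imsetP => -[x _ /setP/(_ x)]; rewrite !inE eqxx.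
rewrite cards0 expr0 big_imset /= => [|x y _ _ /set1_inj //].
rewrite (eq_bigr (fun=> -1)) => [|x _]; last by rewrite cards1.
by rewrite sumr_const mulNrn.
Qed.

End OrderFixed.

Section GraphAction.

Context (n : nat).
Implicit Types (s : {perm 'I_n}) (e : edge n) (G : graph n).

Lemma card_edge_map s e : #|s @: ends e| == 2.
Proof. by rewrite card_imset ?card_ends //; apply: perm_inj. Qed.

Definition edge_map s e := Edge (card_edge_map s e).

Lemma edge_map_inj s : injective (edge_map s).
Proof. by move=> e f [/imset_inj ef]; apply/val_inj/ef/perm_inj. Qed.

Definition graph_perm s : {perm graph n} := perm (imset_inj (@edge_map_inj s)).

Lemma graph_permE s G : graph_perm s G = edge_map s @: G.
Proof. exact: permE. Qed.

Lemma edge_mapM s s' e : edge_map (s * s')%g e = edge_map s' (edge_map s e).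
Proof.
apply: val_inj => /=; rewrite -imset_comp; apply: eq_imset => i.
by rewrite permM.
Qed.

Lemma graph_permM s s' G : graph_perm (s * s')%g G = graph_perm s' (graph_perm s G).
Proof.
rewrite !graph_permE -imset_comp; apply: eq_imset => e; exact: edge_mapM.
Qed.

Lemma graph_perm1 G : graph_perm 1%g G = G.
Proof.
rewrite graph_permE -[RHS]imset_id; apply: eq_imset => e; apply: val_inj => /=.
by rewrite -[RHS]imset_id; apply: eq_imset => i; rewrite perm1.
Qed.

Lemma graph_permX s i G : graph_perm (s ^+ i)%g G = iter i (graph_perm s) G.
Proof.
elim: i => [|i IHi]; first by rewrite expg0 graph_perm1.
by rewrite expgSr graph_permM IHi.
Qed.

Lemma graph_perm_mono s : {mono graph_perm s : G H / properset G H}.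
Proof.
move=> G H; rewrite /properset !graph_permE !properEneq.
rewrite (inj_eq (imset_inj (@edge_map_inj s))); congr (_ && _).
apply/idP/idP => [/subsetP GH|]; last exact: imsetS.
by apply/subsetP => e eG; rewrite -(mem_imset _ _ (@edge_map_inj s)) GH ?imset_f.
Qed.

Lemma graph_perm_isomorphic s G : isomorphic G (graph_perm s G).
Proof.
exists s => i j; rewrite graph_permE; apply/exists_inP/exists_inP => -[e].
  move=> /imsetP[f fG ->] /eqP/= sf; exists f => //; apply/eqP.
  by apply: (imset_inj (@perm_inj _ s)); rewrite sf imsetU1 imset_set1.
move=> eG /eqP eij; exists (edge_map s e); first exact: imset_f.
by rewrite /= eij imsetU1 imset_set1.
Qed.

Lemma graph_perm_property (P : {set graph n}) s G : graph_property P ->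
  (graph_perm s G \in P) = (G \in P).
Proof.
move=> P_iso; apply/idP/idP; last exact/P_iso/graph_perm_isomorphic.
rewrite -[X in _ -> X \in P](graph_perm1 G) -(mulgV s) graph_permM.
exact/P_iso/graph_perm_isomorphic.
Qed.

Lemma graph_perm_eq0 s G : (graph_perm s G == set0) = (G == set0).
Proof. by rewrite graph_permE imset_eq0. Qed.

End GraphAction.

(** * The two candidate graphs *)

Section Apex.

Context (q : nat).
Implicit Types (e : edge (q + 1)) (i : 'I_q).

Definition apex : 'I_(q + 1) := rshift q ord0.

Lemma lshift_neq_apex i : lshift 1 i != apex.
Proof. by rewrite eq_lrshift. Qed.

Lemma vertex_cases (w : 'I_(q + 1)) : {i | w = lshift 1 i} + {w = apex}.
Proof.
case: (split_ordP w) => [i ->|j ->]; [by left; exists i | right].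
by rewrite (ord1 j).
Qed.

Lemma edge_cases e :
  (apex \notin ends e /\ exists i j, i != j /\ ends e = [set lshift 1 i; lshift 1 j]) \/
  (apex \in ends e /\ exists i, ends e = [set lshift 1 i; apex]).
Proof.
case: e => /= E /cards2P[x [y [xy ->]]].
case: (vertex_cases x) xy => [[i ->]|->]; case: (vertex_cases y) => [[j ->]|->] xy.
- left; split; last by exists i, j; split=> //; apply: contraNneq xy => ->.
  by rewrite !inE !(eq_sym apex) !(negPf (lshift_neq_apex _)).
- by right; rewrite !inE eqxx orbT; split=> //; exists i.
- by right; rewrite !inE eqxx; split=> //; exists j; rewrite setUC.
- by rewrite eqxx in xy.
Qed.

(** Both candidates are characterized by incidence with the apex, which every permutation fixing the
    apex preserves; this also shows them to be complementary. *)
Lemma in_complete_union e :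
  (e \in disjoint_union (complete q) (complete 1)) = (apex \notin ends e).
Proof.
rewrite inE; apply/orP/idP => [[/exists_inP[f _ /eqP->]|/exists_inP[f _ _]]|].
- by apply/imsetP => -[i _ /esym/eqP]; rewrite (negPf (lshift_neq_apex i)).
- by have := max_card (ends f); rewrite (eqP (card_ends f)) card_ord.
case: (edge_cases e) => [[_ [i [j [ij eij]]]] _|[-> //]]; left.
have ij2 : #|[set i; j]| == 2 by rewrite cards2 ij.
apply/exists_inP; exists (Edge ij2); first by rewrite inE.
by rewrite eij imsetU1 imset_set1.
Qed.

Lemma in_complete_bipartite1 e :
  (e \in complete_bipartite q 1) = (apex \in ends e).
Proof.
rewrite inE; apply/existsP/idP => [[i /existsP[j /eqP->]]|].
  by rewrite (ord1 j) !inE eqxx orbT.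
case: (edge_cases e) => [[/negPf-> //]|[_ [i ->]] _].
by exists i; apply/existsP; exists ord0; rewrite eqxx.
Qed.

Lemma card_complete_bipartite1 : q <= #|complete_bipartite q 1|.
Proof.
have star2 i : #|[set lshift 1 i; apex]| == 2 by rewrite cards2 lshift_neq_apex.
rewrite -[X in X <= _]card_ord -(card_imset (f := fun i => Edge (star2 i)) predT).
  apply: subset_leq_card; apply/subsetP => _ /imsetP[i _ ->].
  by rewrite in_complete_bipartite1 !inE eqxx orbT.
move=> i j [/setP/(_ (lshift 1 i))]; rewrite !inE eqxx /= => /esym/orP[/eqP/lshift_inj //|].
by rewrite (negPf (lshift_neq_apex i)).
Qed.

Lemma card_complete_union : 'C(q, 2) <= #|disjoint_union (complete q) (complete 1)|.
Proof.
have edge2 (f : edge q) : #|lshift 1 @: ends f| == 2.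
  by rewrite card_imset ?card_ends //; apply: lshift_inj.
rewrite -card_edge -(card_imset (f := fun f => Edge (edge2 f)) predT).
  apply: subset_leq_card; apply/subsetP => _ /imsetP[f _ ->].
  rewrite in_complete_union /=; apply/imsetP => -[i _ /esym/eqP].
  by rewrite (negPf (lshift_neq_apex i)).
move=> f g [fg]; apply/val_inj; apply: imset_inj fg; exact: lshift_inj.
Qed.

End Apex.

(** * Affine maps of the field as vertex permutations *)

Section Affine.

Local Open Scope ring_scope.

Context (F : finFieldType) (q : nat) (h : F -> 'I_q) (h_bij : bijective h).
Implicit Types (x y b c : F).

Let v x : 'I_(q + 1) := lshift 1 (h x).

Lemma lshift_field (i : 'I_q) : exists x, i = h x.
Proof. by case: h_bij => h' _ hK; exists (h' i); rewrite hK. Qed.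

Let v_inj : injective v.
Proof. by move=> x y /lshift_inj; apply: bij_inj. Qed.

Lemma affine_perm_subproof (s : {perm F}) :
  {u : {perm 'I_(q + 1)} | u (apex q) = apex q & forall x, u (v x) = v (s x)}.
Proof.
apply: cid2; have [h' hK h'K] := h_bij.
pose f (w : 'I_(q + 1)) :=
  match split w with inl i => v (s (h' i)) | inr _ => apex q end.
have fv x : f (v x) = v (s x).
  by rewrite /f /v -[lshift 1 _]/(unsplit (inl _)) unsplitK hK.
have fa : f (apex q) = apex q by rewrite /f -[apex q]/(unsplit (inr _)) unsplitK.
have f_inj : injective f.
  move=> w w'; case: (vertex_cases w) => [[i ->]|->]; case: (vertex_cases w') => [[j ->]|->] //.
  - have [x ->] := lshift_field i; have [y ->] := lshift_field j.
    by rewrite !fv => /v_inj/perm_inj->.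
  - have [x ->] := lshift_field i; rewrite fv fa => /eqP.
    by rewrite (negPf (lshift_neq_apex _)).
  - have [x ->] := lshift_field j; rewrite fv fa => /esym/eqP.
    by rewrite (negPf (lshift_neq_apex _)).
by exists (perm f_inj) => [|x]; rewrite permE.
Qed.

Definition field_perm s := s2val (affine_perm_subproof s).

Lemma field_perm_apex s : field_perm s (apex q) = apex q.
Proof. by rewrite /field_perm; case: affine_perm_subproof. Qed.

Lemma field_permE s x : field_perm s (v x) = v (s x).
Proof. by rewrite /field_perm; case: affine_perm_subproof. Qed.

Lemma eq_field_perm (u u' : {perm 'I_(q + 1)}) : u (apex q) = u' (apex q) ->
  (forall x, u (v x) = u' (v x)) -> u = u'.
Proof.
move=> ua uv; apply/permP => w; case: (vertex_cases w) => [[i ->]|->] //.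
by have [x ->] := lshift_field i; apply: uv.
Qed.

Lemma field_permM s s' : field_perm (s * s')%g = (field_perm s * field_perm s')%g.
Proof.
apply: eq_field_perm => [|x]; first by rewrite permM !field_perm_apex.
by rewrite permM !field_permE permM.
Qed.

Lemma field_perm1 : field_perm 1%g = 1%g.
Proof.
apply: eq_field_perm => [|x]; first by rewrite perm1 field_perm_apex.
by rewrite field_permE !perm1.
Qed.

Definition translation b : {perm F} := perm (addIr b).

Definition homothety (a : {unit F}) : {perm F} := perm (mulrI (valP a)).

Lemma translationE b x : translation b x = x + b.
Proof. exact: permE. Qed.

Lemma homothetyE a x : homothety a x = val a * x.
Proof. exact: permE. Qed.

Definition translation_act b := graph_perm (field_perm (translation b)).
Definition homothety_act a := graph_perm (field_perm (homothety a)).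

Lemma translation_actC b c G :
  translation_act b (translation_act c G) = translation_act c (translation_act b G).
Proof.
rewrite /translation_act -!graph_permM -!field_permM; congr (graph_perm (field_perm _) G).
by apply/permP => x; rewrite !permM !translationE addrAC.
Qed.

(** Homotheties normalize the translations, hence preserve the set of graphs fixed by all of
    them. *)
Lemma homothety_translation_act a b G :
  homothety_act a (translation_act b G) = translation_act (val a * b) (homothety_act a G).
Proof.
rewrite /homothety_act /translation_act -!graph_permM -!field_permM.
congr (graph_perm (field_perm _) G).
by apply/permP => x; rewrite !permM !translationE !homothetyE mulrDr.
Qed.

Lemma translation_act_order p b G : p%:R = 0 :> F ->
  iter p (translation_act b) G = G.
Proof.
move=> p0; rewrite -graph_permX.
suff -> : (field_perm (translation b) ^+ p)%g = 1%g by rewrite graph_perm1.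
have -> i : (field_perm (translation b) ^+ i)%g = field_perm (translation (b *+ i)).
  elim: i => [|i IHi].
    rewrite expg0 -field_perm1; congr field_perm.
    by apply/permP => x; rewrite perm1 translationE addr0.
  rewrite expgSr IHi -field_permM; congr field_perm.
  by apply/permP => x; rewrite permM !translationE mulrSr addrA.
rewrite -mulr_natr p0 mulr0 -field_perm1; congr field_perm.
by apply/permP => x; rewrite perm1 translationE addr0.
Qed.

Lemma homothety_actX a i G : homothety_act (a ^+ i)%g G = iter i (homothety_act a) G.
Proof.
rewrite -graph_permX; congr (graph_perm _ G); elim: i => [|i IHi].
  rewrite !expg0 -field_perm1; congr field_perm.
  by apply/permP => x; rewrite perm1 homothetyE /= mul1r.
rewrite [RHS]expgSr -IHi -field_permM; congr field_perm.
by apply/permP => x; rewrite permM !homothetyE expgSr /= mulrA [_ * val (a ^+ i)%g]mulrC.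
Qed.

Lemma graph_perm_fix_graph (s : {perm 'I_(q + 1)}) (G : graph (q + 1)) :
  s (apex q) = apex q ->
  G = disjoint_union (complete q) (complete 1) \/ G = complete_bipartite q 1 ->
  graph_perm s G = G.
Proof.
move=> sa GE; apply/eqP; rewrite graph_permE eqEcard card_imset ?leqnn ?andbT; last first.
  exact: edge_map_inj.
have apex_map e : (apex q \in ends (edge_map s e)) = (apex q \in ends e).
  by rewrite /= -[X in X \in _]sa (mem_imset _ _ perm_inj).
apply/subsetP => _ /imsetP[e + ->].
by case: GE => ->; rewrite ?in_complete_union ?in_complete_bipartite1 apex_map.
Qed.

(** Edges off the apex form one orbit, by 2-transitivity of affine maps on [F]; edges at the apex
    form another, by transitivity of translations. A fixed graph is a union of these orbits. *)
Lemma affine_fixed_graph (a : {unit F}) (G : graph (q + 1)) :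
  <[a]>%g = [set: {unit F}] ->
  (forall b, translation_act b G = G) -> homothety_act a G = G ->
  [\/ G = set0, G = disjoint_union (complete q) (complete 1),
      G = complete_bipartite q 1 | G = setT].
Proof.
move=> gen_a transG homG.
have homG' (c : {unit F}) : homothety_act c G = G.
  have /cycleP[i ->] : c \in <[a]>%g by rewrite gen_a inE.
  by rewrite homothety_actX; elim: i => //= i ->.
have affG (c : {unit F}) b e : e \in G ->
    edge_map (field_perm (translation b)) (edge_map (field_perm (homothety c)) e) \in G.
  move=> eG; rewrite -(transG b) /translation_act graph_permE; apply: imset_f.
  by rewrite -(homG' c) /homothety_act graph_permE; apply: imset_f.
have leftG e : e \in G -> apex q \notin ends e ->
    disjoint_union (complete q) (complete 1) \subset G.
  move=> eG ea; apply/subsetP => f; rewrite in_complete_union => fa.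
  case: (edge_cases e) => [[_ [i [j [ij eij]]]]|[ea' _]]; last by rewrite ea' in ea.
  case: (edge_cases f) => [[_ [i' [j' [ij' fij]]]]|[fa' _]]; last by rewrite fa' in fa.
  have [x xi] := lshift_field i; have [y yj] := lshift_field j.
  have [x' xi'] := lshift_field i'; have [y' yj'] := lshift_field j'.
  have xy : y - x != 0.
    by rewrite subr_eq0; apply: contraNneq ij => xy; rewrite xi yj xy.
  have xy' : y' - x' != 0.
    by rewrite subr_eq0; apply: contraNneq ij' => xy'; rewrite xi' yj' xy'.
  (* The affine map with slope c = (y' - x') / (y - x) and translation part x' - c x sends x to x'
     and y to y'. *)
  have c_unit : (y' - x') / (y - x) \is a GRing.unit
    by rewrite unitfE mulf_neq0 ?invr_eq0.
  pose c := FinRing.unit F c_unit.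
  have /(affG c (x' - val c * x)) := eG; congr (_ \in G); apply: val_inj => /=.
  rewrite eij fij !imsetU1 !imset_set1 xi yj xi' yj' -!/(v _) !field_permE.
  rewrite !translationE !homothetyE addrC subrK; congr [set _; v _].
  by rewrite addrCA -mulrBr /= divfK // addrC subrK.
have starG e : e \in G -> apex q \in ends e -> complete_bipartite q 1 \subset G.
  move=> eG ea; apply/subsetP => f; rewrite in_complete_bipartite1 => fa.
  case: (edge_cases e) => [[ea' _]|[_ [i ei]]]; first by rewrite ea in ea'.
  case: (edge_cases f) => [[fa' _]|[_ [i' fi']]]; first by rewrite fa in fa'.
  have [x xi] := lshift_field i; have [x' xi'] := lshift_field i'.
  have : edge_map (field_perm (translation (x' - x))) e \in G.
    by rewrite -(transG (x' - x)) /translation_act graph_permE; apply: imset_f.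
  congr (_ \in G); apply: val_inj => /=.
  rewrite ei fi' !imsetU1 !imset_set1 xi xi' -!/(v _) !field_permE field_perm_apex.
  by rewrite translationE addrC subrK.
have [/exists_inP[e eG ea]|/exists_inPn noleft] := boolP [exists e in G, apex q \notin ends e];
have [/exists_inP[f fG fa]|/exists_inPn nostar] := boolP [exists e in G, apex q \in ends e].
- constructor 4; apply/setP => g; rewrite inE.
  case: (boolP (apex q \in ends g)) => ga.
    by apply: (subsetP (starG f fG fa)); rewrite in_complete_bipartite1.
  by apply: (subsetP (leftG e eG ea)); rewrite in_complete_union.
- constructor 2; apply/eqP; rewrite eqEsubset (leftG e) // andbT.
  by apply/subsetP => g gG; rewrite in_complete_union nostar.
- constructor 3; apply/eqP; rewrite eqEsubset (starG f) // andbT.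
  by apply/subsetP => g /noleft; rewrite negbK in_complete_bipartite1.
constructor 1; apply/setP => g; rewrite inE; apply/negP => gG.
by have := noleft g gG; rewrite (negPf (nostar g gG)).
Qed.

End Affine.

(** The set [Z] of nonempty members of [P] fixed by all affine maps is an antichain inside {L, S},
    as the complete graph is excluded. The Lefschetz formula reads 1 - #|Z| = 0 in ['F_p], and #|Z|
    is at most 2, so it is 1. *)
Lemma prime_power_nonevasive_xor (p r : nat) (P : {set graph (p ^ r + 1)}) :
  prime p -> 0 < r -> 3 < p ^ r + 1 ->
  graph_property P -> P != set0 -> monotone P -> ~~ evasive P -> setT \notin P ->
  (disjoint_union (complete (p ^ r)) (complete 1) \in P)
    (+) (complete_bipartite (p ^ r) 1 \in P).
Proof.
move=> p_prime r_gt0 n_gt3 P_iso P_n0 P_mono P_ne P_nT.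
set L := disjoint_union _ _; set S := complete_bipartite _ _.
have [F pF cardF] := pPrimePowerField p_prime r_gt0.
have h_bij : bijective (cast_ord cardF \o enum_rank : F -> 'I_(p ^ r)).
  apply: bij_comp (@enum_rank_bij F).
  by exists (cast_ord (esym cardF)); [apply: cast_ordK | apply: cast_ordKV].
(* Cyclicity matters: the Lefschetz formula concerns a single map, and a generator has the same
   fixed graphs as all homotheties together. *)
have [a gen_a] : exists a : {unit F}, <[a]>%g = [set: {unit F}].
  by have /cyclicP[a aE] := field_unit_group_cyclic [set: {unit F}]%G; exists a.
have p_char := pchar_Fp_0 p_prime.
have lt_irr := @properset_irr (edge (p ^ r + 1)).
have lt_trans := @properset_trans (edge (p ^ r + 1)).
pose X := P :\ set0.
have acX : acyclic 'F_p (@properset (edge (p ^ r + 1))) X.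
  apply: nonevasive_acyclic P_mono P_n0 _.
  by rewrite card_edge; exact: P_ne.
have actX s G : (graph_perm s G \in X) = (G \in X).
  by rewrite !inE graph_perm_eq0 graph_perm_property.
pose ts := [seq translation_act h_bij b | b <- enum F].
have acY := smith_acyclic_seq lt_irr lt_trans p_prime p_char (X := X) (ts := ts) _ _ acX.
set Y := [set G in X | _] in acY.
have {}acY : acyclic 'F_p (@properset (edge (p ^ r + 1))) Y.
  apply: acY => [_ /mapP[b _ ->]|_ _ /mapP[b _ ->] /mapP[c _ ->] G].
    split; [exact: graph_perm_mono | exact: actX | move=> G].
    exact/translation_act_order/(pcharf0 pF).
  exact: translation_actC.
have YP G : reflect (G \in X /\ forall b, translation_act h_bij b G = G) (G \in Y).
  rewrite [G \in Y]inE; apply: (iffP andP) => -[GX tG]; split=> //.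
    by move=> b; apply/eqP/(allP tG)/map_f; rewrite mem_enum.
  by apply/allP => _ /mapP[b _ ->]; rewrite tG.
have homY G : (homothety_act h_bij a G \in Y) = (G \in Y).
  apply/YP/YP => -[GX tG]; split; rewrite ?actX // in GX * => b.
    apply: (@perm_inj _ (homothety_act h_bij a)).
    by rewrite homothety_translation_act tG.
  (* Every translation vector b is a times a^-1 b, so translating by b after the homothety amounts
     to translating by a^-1 b before it. *)
  rewrite -[b](mulVKr (valP a)) -homothety_translation_act tG //.
have q_ge3 : 2 < p ^ r by rewrite addn1 in n_gt3.
have L_n0 : L != set0.
  by rewrite -card_gt0 (leq_trans _ (card_complete_union _)) // bin_gt0 ltnW.
have S_n0 : S != set0.
  by rewrite -card_gt0 (leq_trans _ (card_complete_bipartite1 _)) // ltnW // ltnW.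
have S_setC : S = ~: L.
  by apply/setP => e; rewrite in_setC in_complete_union in_complete_bipartite1 negbK.
have nLS : ~~ comparable (@properset _) L S.
  rewrite /comparable S_setC; apply/or3P => -[/eqP LS|/proper_sub LS|/proper_sub LS].
  - by case/set0Pn: L_n0 => e eL; have := eL; rewrite {1}LS in_setC eL.
  - by case/set0Pn: L_n0 => e eL; have := subsetP LS e eL; rewrite in_setC eL.
  case/set0Pn: S_n0 => e; rewrite S_setC => eS.
  by have := subsetP LS e eS; apply/negP; rewrite in_setC in eS.
have := lefschetz lt_irr lt_trans (graph_perm_mono _) homY acY.
set Z := [set G in Y | _].
have ZE : Z = [set G in [set L; S] | G \in P].
  apply/setP => G; rewrite [G \in Z]inE [RHS]inE in_set2.
  apply/andP/andP => [[/YP[GX tG] /eqP hG]|[LSG GP]].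
    have [G0 GP] := setD1P GX.
    case: (affine_fixed_graph gen_a tG hG) => GE; rewrite GE in G0 GP *.
    - by rewrite eqxx in G0.
    - by rewrite eqxx.
    - by rewrite eqxx orbT.
    - by rewrite (negPf P_nT) in GP.
  have fixG s : graph_perm (field_perm h_bij s) G = G.
    apply: graph_perm_fix_graph; first exact: field_perm_apex.
    by case/orP: LSG => /eqP; [left | right].
  split; last by apply/eqP/fixG.
  apply/YP; split=> [|b]; last exact: fixG.
  by rewrite !inE GP andbT; case/orP: LSG => /eqP->.
have cardZ : #|Z| = (L \in P) + (S \in P).
  rewrite ZE -sum1_card (eq_bigl (fun G => (G \in [set L; S]) && (G \in P))); last first.
    by move=> G; rewrite inE.
  rewrite big_mkcondr big_setU1 /=; last first.
    by rewrite in_set1; apply: contraNneq nLS => <-; rewrite /comparable eqxx.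
  by rewrite big_set1; do 2!case: (_ \in P).
rewrite antichain_sum => [|G H]; last first.
  rewrite ZE !inE => /andP[/orP[]/eqP-> _] /andP[/orP[]/eqP-> _] //.
    by rewrite (negPf nLS).
  by rewrite comparableC (negPf nLS).
(* The left-hand side would be 1 - 2 = -1 with both graphs in [P] and 1 with neither; both are
   nonzero in ['F_p]. *)
rewrite cardZ; case: (L \in P); case: (S \in P) => //= /eqP.
  by rewrite natrD opprD addrA subrr sub0r oppr_eq0 oner_eq0.
by rewrite subr0 oner_eq0.
Qed.

Theorem corollary4p3 (p r : nat) (P : {set graph (p ^ r + 1)})
    (p_prime : prime p) (r_ge1 : 1 <= r) (n_gt3 : 3 < p ^ r + 1)
    (P_property : graph_property P) (P_nonempty : P != set0)
    (P_monotone : monotone P) (P_nonevasive : ~~ evasive P) :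
  (disjoint_union (complete (p ^ r)) (complete 1) \in P
     \/ complete_bipartite (p ^ r) 1 \in P)
  /\ ((p ^ r + 1)%:Z - 2%:Z <= complex_dim P)%R
  /\ (~~ trivial_property P ->
      ~ (disjoint_union (complete (p ^ r)) (complete 1) \in P
         /\ complete_bipartite (p ^ r) 1 \in P)).
Proof.
have xorP := prime_power_nonevasive_xor p_prime r_ge1 n_gt3 P_property P_nonempty
  P_monotone P_nonevasive.
have one_in : disjoint_union (complete (p ^ r)) (complete 1) \in P
     \/ complete_bipartite (p ^ r) 1 \in P.
  have [PT|/xorP] := boolP (setT \in P).
    by left; apply: P_monotone PT; apply: subsetT.
  by case: (_ \in P); [left | right].
split=> //; split.
  have [G GP ltG] : exists2 G, G \in P & p ^ r <= #|G|.
    case: one_in => GP; eexists; try exact: GP.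
      apply: leq_trans (card_complete_union _).
      (* Since q = p^r is at least 3, q - 1 is at least 2 and q (q - 1) / 2 is at least q. *)
      rewrite bin2 -[X in X <= _]doubleK half_leq // -muln2 leq_mul2l.
      have q_ge3 : 2 < p ^ r by rewrite addn1 in n_gt3.
      by rewrite -ltnS prednK ?q_ge3 ?orbT // (ltn_trans _ q_ge3).
    exact: card_complete_bipartite1.
  have : p ^ r <= \max_(A in P) #|A|.
    exact: leq_trans ltG (leq_bigmax_cond (F := fun A : graph _ => #|A|) G GP).
  (* As n - 2 = p^r - 1, the -1 in the dimension cancels. *)
  by rewrite /complex_dim PoszD -addrA -[(_ - 2%:Z)%R]/(- 1%:Z)%R Num.Theory.lerD2r lez_nat.
rewrite negb_or => /andP[_ PT] [LP SP].
(* A monotone property containing the complete graph contains every graph, hence is trivial. *)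
have /xorP : setT \notin P.
  apply: contra PT => TP; apply/eqP/setP => G; rewrite inE.
  by apply: P_monotone TP; apply: subsetT.
by rewrite LP SP.
Qed.
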